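(* The entropy rate coefficient $\mathfrak E$ and the action rate coefficient $\mathfrak D$ of the comparison of an admissible piecewise constant fan subsolution with a piecewise constant self-similar reference solution satisfy $$\mathfrak E=-\tfrac12\mathfrak K+\mathfrak I,\qquad \mathfrak D=\tfrac12\mathfrak K+\mathfrak I,$$ where $\mathfrak K$ and $\mathfrak I$ are the kinetic and internal energy mismatches.
   Context: $e:(0,\infty)\to\mathbb R$ is the specific internal energy of a pressure law ($p(\rho)=\rho^2e'(\rho)$, $p'>0$). The fan and the reference solution have the same Riemann data $(\rho_\pm,v_\pm)$; only the following data enter. Fan: speeds $\nu_0<\nu_1<\dots<\nu_N$, densities $\rho_i>0$ and kinetic levels $C_i>0$ ($i=1,\dots,N$). Set $H_i=\tfrac12\rho_iC_i+\rho_ie(\rho_i)$, $\Lambda_i=\tfrac12\rho_iC_i-\rho_ie(\rho_i)$, $H_\pm=\tfrac12\rho_\pm|v_\pm|^2+\rho_\pm e(\rho_\pm)$, $\Lambda_\pm=\tfrac12\rho_\pm|v_\pm|^2-\rho_\pm e(\rho_\pm)$. In the variable $\xi=x_2/t$, $H^{\mathrm{fan}}$ equals $H_-$ for $\xi<\nu_0$, $H_i$ for $\nu_{i-1}<\xi<\nu_i$, $H_+$ for $\xi>\nu_N$; $\Lambda^{\mathrm{fan}}$ likewise with $\Lambda_-,\Lambda_i,\Lambda_+$. Reference: a partition $-\infty=\sigma_0<\sigma_1<\dots<\sigma_M=\infty$ and constants $\rho_j^{\mathrm{ref}}>0$, $v_j^{\mathrm{ref}}\in\mathbb R^2$, with $C_j^{\mathrm{ref}}:=|v_j^{\mathrm{ref}}|^2$;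 $H^{\mathrm{ref}}(\xi)=\tfrac12\rho_j^{\mathrm{ref}}C_j^{\mathrm{ref}}+\rho_j^{\mathrm{ref}}e(\rho_j^{\mathrm{ref}})$ and $\Lambda^{\mathrm{ref}}(\xi)=\tfrac12\rho_j^{\mathrm{ref}}C_j^{\mathrm{ref}}-\rho_j^{\mathrm{ref}}e(\rho_j^{\mathrm{ref}})$ for $\sigma_{j-1}<\xi<\sigma_j$. Standing assumption: the fan and reference profiles agree for $\xi<\nu_0$ and for $\xi>\nu_N$. Rate coefficients: $\mathfrak E=\int_{\mathbb R}[H^{\mathrm{fan}}-H^{\mathrm{ref}}]\,d\xi$, $\mathfrak D=\int_{\mathbb R}[\Lambda^{\mathrm{ref}}-\Lambda^{\mathrm{fan}}]\,d\xi$. Mismatches: with $\omega_{ij}=\max\{0,\min\{\nu_i,\sigma_j\}-\max\{\nu_{i-1},\sigma_{j-1}\}\}$, $$\mathfrak K=\sum_{i=1}^N\sum_{j=1}^M\omega_{ij}\left(\rho_j^{\mathrm{ref}}C_j^{\mathrm{ref}}-\rho_iC_i\right),\qquad \mathfrak I=\sum_{i=1}^N\sum_{j=1}^M\omega_{ij}\left[\rho_ie(\rho_i)-\rho_j^{\mathrm{ref}}e(\rho_j^{\mathrm{ref}})\right].$$ *)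

(* Defs.v *)
From HB Require Import structures.
From mathcomp Require Import all_boot all_order all_algebra.
From mathcomp Require Import all_classical all_reals all_analysis.
Set Implicit Arguments.
Unset Strict Implicit.
Unset Printing Implicit Defensive.
Import Order.TTheory GRing.Theory Num.Theory.
Import numFieldNormedType.Exports.
Local Open Scope classical_set_scope.
Local Open Scope ring_scope.

(* The specific internal energy e : (0, +oo) -> R is represented by a total
   function that is only ever constrained and evaluated at positive densities. *)
Definition pressure (R : realType) (e : R -> R) (r : R) : R :=
  r ^+ 2 * derive1 e r.

Definition internal_energy (R : realType) (e : R -> R) : Prop :=
  forall r : R, 0 < r ->
    [/\ derivable e r 1, derivable (pressure e) r 1 & 0 < derive1 (pressure e) r].

(* The library norm on row vectors is the sup norm, hence the explicit
   squared Euclidean norm. *)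
Definition sqnorm (R : realType) (v : 'rV[R]_2) : R :=
  \sum_(k < 2) v 0 k ^+ 2.

Definition energy_density (R : realType) (e : R -> R) (rho C : R) : R :=
  2^-1 * rho * C + rho * e rho.

Definition action_density (R : realType) (e : R -> R) (rho C : R) : R :=
  2^-1 * rho * C - rho * e rho.

(* Finite families are indexed by nat with the customary numbering: speeds
   nu 0 < ... < nu N, wedge i (1 <= i <= N) lying between nu i.-1 and nu i, and
   likewise for sigma; values at other indices are never used.
   The profiles are prescribed only off the discontinuities, where they may
   take any value. *)
Definition fan_speeds (R : realType) (N : nat) (nu : nat -> R) : Prop :=
  forall i : nat, (1 <= i <= N)%N -> nu i.-1 < nu i.

Definition fan_profile (R : realType) (N : nat) (nu : nat -> R)
    (qm : R) (q : nat -> R) (qp : R) (f : R -> R) : Prop :=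
  [/\ forall xi : R, xi < nu 0%N -> f xi = qm,
      forall (i : nat) (xi : R), (1 <= i <= N)%N ->
        nu i.-1 < xi < nu i -> f xi = q i
    & forall xi : R, nu N < xi -> f xi = qp].

Definition ref_partition (R : realType) (M : nat) (sigma : nat -> \bar R) :
    Prop :=
  [/\ sigma 0%N = -oo%E, sigma M = +oo%E
    & forall j : nat, (1 <= j <= M)%N -> (sigma j.-1 < sigma j)%E].

Definition ref_profile (R : realType) (M : nat) (sigma : nat -> \bar R)
    (q : nat -> R) (f : R -> R) : Prop :=
  forall (j : nat) (xi : R), (1 <= j <= M)%N ->
    (sigma j.-1 < xi%:E < sigma j)%E -> f xi = q j.

Definition agree_outside_fan (R : realType) (N M : nat) (nu : nat -> R)
    (sigma : nat -> \bar R) (f g : R -> R) : Prop :=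
  forall xi : R, xi < nu 0%N \/ nu N < xi ->
    (forall j : nat, (0 < j < M)%N -> sigma j <> xi%:E) -> f xi = g xi.

(* The rate coefficients are extended-real integrals, so that equating them
   with a real number includes their finiteness. *)
Definition entropy_rate (R : realType) (Hfan Href : R -> R) : \bar R :=
  (\int[@lebesgue_measure R]_(xi in [set: R]) (Hfan xi - Href xi)%:E)%E.

Definition action_rate (R : realType) (Lfan Lref : R -> R) : \bar R :=
  (\int[@lebesgue_measure R]_(xi in [set: R]) (Lref xi - Lfan xi)%:E)%E.

(* For i, j >= 1 the argument of fine is finite: nu is real-valued, and
   sigma j > -oo, sigma j.-1 < +oo. *)
Definition overlap (R : realType) (nu : nat -> R) (sigma : nat -> \bar R)
    (i j : nat) : R :=
  fine (Order.max 0 (Order.min (nu i)%:E (sigma j)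
                     - Order.max (nu i.-1)%:E (sigma j.-1)))%E.

Definition kinetic_mismatch (R : realType) (N M : nat) (nu : nat -> R)
    (sigma : nat -> \bar R) (rho C rhoref Cref : nat -> R) : R :=
  \sum_(1 <= i < N.+1) \sum_(1 <= j < M.+1)
    overlap nu sigma i j * (rhoref j * Cref j - rho i * C i).

Definition internal_mismatch (R : realType) (N M : nat) (nu : nat -> R)
    (sigma : nat -> \bar R) (e : R -> R) (rho rhoref : nat -> R) : R :=
  \sum_(1 <= i < N.+1) \sum_(1 <= j < M.+1)
    overlap nu sigma i j * (rho i * e (rho i) - rhoref j * e (rhoref j)).

(* Main.v *)
Require Import Defs.
From HB Require Import structures.
From mathcomp Require Import all_boot all_order all_algebra.
From mathcomp Require Import all_classical all_reals all_analysis.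
From mathcomp Require Import ring.
Set Implicit Arguments.
Unset Strict Implicit.
Unset Printing Implicit Defensive.
Import Order.TTheory GRing.Theory Num.Theory.
Import numFieldNormedType.Exports.
Local Open Scope classical_set_scope.
Local Open Scope ring_scope.

(** Off the finitely many break points [nu i] and [sigma j], the difference of
    the fan and the reference profile vanishes outside the fan, and inside it is
    constant on each cell, the intersection of a fan wedge with a reference
    sector.  These cells are open intervals, whose lengths are the overlaps, so
    the integral of the difference over the line is the sum over the cells of
    overlap times jump ([integral_overlaps]).  This formula is linear in the
    jump.  Both the energy and the action density are combinations of the
    kinetic quantity [rho * C] and the internal energy [rho * e rho]: the
    kinetic jumps sum to a multiple of the kinetic mismatch and the internal
    jumps to the internal one.  The energy carries both with the same sign, the
    action with opposite signs; as the action rate integrates reference minus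
    fan instead of fan minus reference, the internal parts of the two rates
    agree and the kinetic parts are opposite.

    Each profile is prescribed only off its own break points.  A function that
    differs from an integrable one at finitely many points differs from it by a
    finite combination of indicators of singletons, which settles integrability
    and the value of the integral together ([has_integral_eq_off_seq]). *)

(** * Integrals of step functions on the line *)

(** Integrability and value are recorded together: additivity of the integral
    needs the former, and the pair is stable under finite sums. *)
Definition has_integral (R : realType) (f : R -> R) (v : R) : Prop :=
  (@lebesgue_measure R).-integrable [set: R] (EFin \o f) /\
  (\int[@lebesgue_measure R]_(xi in [set: R]) (f xi)%:E)%E = v%:E.

Lemma has_integral_ext (R : realType) (f g : R -> R) (v : R) :
  f =1 g -> has_integral f v -> has_integral g v.
Proof. by move=> /funext ->. Qed.

Lemma has_integral0 (R : realType) : has_integral (fun=> 0 : R) 0.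
Proof. by split; [exact: integrable0 | exact: integral0]. Qed.

Lemma has_integralD (R : realType) (f g : R -> R) (v w : R) :
  has_integral f v -> has_integral g w ->
  has_integral (fun x => f x + g x) (v + w).
Proof.
move=> [fint fv] [gint gw]; split; first exact: (integrableD _ fint gint).
have := integralD_EFin measurableT fint gint.
by rewrite /= fv gw -EFinD.
Qed.

Lemma has_integralZ (R : realType) (c : R) (f : R -> R) (v : R) :
  has_integral f v -> has_integral (fun x => c * f x) (c * v).
Proof.
move=> [fint fv]; split; first exact: (integrableZl _ c fint).
have := integralZl measurableT fint c.
by rewrite /= fv -EFinM.
Qed.

Lemma has_integral_sum (R : realType) (I : eqType) (r : seq I)
    (f : I -> R -> R) (v : I -> R) :
  (forall i, i \in r -> has_integral (f i) (v i)) ->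
  has_integral (fun x => \sum_(i <- r) f i x) (\sum_(i <- r) v i).
Proof.
elim: r => [_|i r IHr fv].
  rewrite big_nil; apply: has_integral_ext (@has_integral0 R) => x.
  by rewrite big_nil.
rewrite big_cons.
apply: (@has_integral_ext _ (fun x => f i x + \sum_(j <- r) f j x)) => [x|].
  by rewrite big_cons.
apply: has_integralD; first by apply: fv; rewrite mem_head.
by apply: IHr => j jr; apply: fv; rewrite inE jr orbT.
Qed.

Lemma has_integral_itv (R : realType) (a b : R) (b0 b1 : bool) :
  has_integral (\1_[set` Interval (BSide b0 a) (BSide b1 b)])
    (Num.max 0 (b - a)).
Proof.
split; first exact: integrable_indic_itv.
rewrite integral_indic// setIT; apply: etrans (lebesgue_measure_itv _) _.
rewrite /= lte_fin.
case: ltP => ab; first by rewrite max_r ?subr_ge0 1?ltW// EFinB.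
by rewrite max_l// subr_le0.
Qed.

Lemma has_integral_set1 (R : realType) (a : R) : has_integral (\1_[set a]) 0.
Proof.
have := has_integral_itv a a true false.
by rewrite subrr maxxx -set_itv1.
Qed.

(** The difference [g - f] is the combination of the indicators of the points of
    [s] whose coefficients are its own values there, and each of these indicators
    integrates to zero. *)
Lemma has_integral_eq_off_seq (R : realType) (s : seq R) (f g : R -> R)
    (v : R) :
  (forall x, x \notin s -> g x = f x) -> has_integral f v -> has_integral g v.
Proof.
move=> gf fv.
have dv : has_integral (fun x => \sum_(a <- undup s) (g a - f a) * \1_[set a] x)
                       (\sum_(a <- undup s) (g a - f a) * 0).
  by apply: has_integral_sum => a _; apply/has_integralZ/has_integral_set1.
rewrite -[v]addr0 -[X in v + X](_ : \sum_(a <- undup s) (g a - f a) * 0 = 0);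
  last by apply: big1 => a _; rewrite mulr0.
apply: has_integral_ext (has_integralD fv dv) => x /=.
have [xs|xs] := boolP (x \in s).
  rewrite (bigD1_seq x) ?mem_undup ?undup_uniq//= big1 => [|a ax].
    by rewrite indicE mem_set// mulr1 addr0 addrC subrK.
  by rewrite indicE memNset ?mulr0// => /= xa; rewrite xa eqxx in ax.
rewrite gf// big_seq big1 ?addr0// => a; rewrite mem_undup => as_.
by rewrite indicE memNset ?mulr0// => /= xa; rewrite xa as_ in xs.
Qed.

(** * Wedges of a finite increasing sequence *)

(** Stated for any total order, since the fan speeds are real and the bounds of
    the reference sectors are extended reals. *)
Lemma wedge_exists (d : Order.disp_t) (T : orderType d) (n : nat)
    (s : nat -> T) (x : T) :
  (s 0 < x)%O -> (x < s n)%O -> (forall k, (k <= n)%N -> x != s k) ->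
  exists2 k, (1 <= k <= n)%N & (s k.-1 < x < s k)%O.
Proof.
move=> s0x; elim: n => [xs0 _|n IHn xsn xs].
  by have := lt_trans s0x xs0; rewrite ltxx.
case: (ltgtP x (s n)) => [xn|nx|/eqP]; last by rewrite (negbTE (xs n _)).
  by have [|k /andP[k1 kn] xk] := IHn xn;
    [move=> k kn; apply: xs; exact: leqW | exists k; rewrite ?k1 ?leqW].
by exists n.+1; rewrite ?leqnn// nx.
Qed.

Section Wedges.
Context (d : Order.disp_t) (T : orderType d) (n : nat) (s : nat -> T).
Hypothesis s_incr : forall k, (1 <= k <= n)%N -> (s k.-1 < s k)%O.

Lemma wedge_le (i j : nat) : (i <= j)%N -> (j <= n)%N -> (s i <= s j)%O.
Proof.
elim: j => [|j IHj]; first by rewrite leqn0 => /eqP->.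
rewrite leq_eqVlt => /predU1P[->//|ij] jn.
exact: le_trans (IHj ij (ltnW jn)) (ltW (s_incr (k := j.+1) jn)).
Qed.

Lemma wedge_uniq (x : T) (i k : nat) :
  (1 <= i <= n)%N -> (s i.-1 < x < s i)%O ->
  (1 <= k <= n)%N -> (s k.-1 < x < s k)%O -> i = k.
Proof.
(* The lower end of the later wedge would be both below [x] and above it. *)
have lt_absurd i' k' : (i' < k')%N -> (k' <= n)%N -> (x < s i')%O ->
    (s k'.-1 < x)%O -> False.
  case: k' => [//|k'] ik kn xi /lt_trans/(_ xi).
  by rewrite ltNge wedge_le// ltnW.
move=> /andP[_ iN] /andP[ix xi] /andP[_ kN] /andP[kx xk].
by case: (ltngtP i k) => // [ik|ki];
  [case: (lt_absurd i k) | case: (lt_absurd k i)].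
Qed.

(** Membership in a cell is a product of two membership weights, so the double
    sum over the cells collapses by this lemma applied to each index in turn. *)
Lemma sum_wedge (R : pzRingType) (F : nat -> R) (x : T) (k : nat) :
  (1 <= k <= n)%N -> (s k.-1 < x < s k)%O ->
  \sum_(1 <= i < n.+1) (s i.-1 < x < s i)%O%:R * F i = F k.
Proof.
move=> kn xk; rewrite (bigD1_seq k) ?mem_index_iota ?iota_uniq//= xk mul1r.
rewrite big_seq_cond big1 ?addr0// => i.
rewrite mem_index_iota ltnS => /andP[iN ik].
have [xi|_] := boolP (s i.-1 < x < s i)%O; last by rewrite mul0r.
by rewrite (wedge_uniq iN xi kn xk) eqxx in ik.
Qed.

End Wedges.

(** * Overlaps of fan wedges and reference sectors *)

(** A nonempty sector has an upper end above [-oo] and a lower end below [+oo],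
    so its intersection with a wedge is a bounded open interval, possibly with
    [b <= a]; its length is the overlap. *)
Lemma overlap_itv (R : realType) (nu : nat -> R) (sigma : nat -> \bar R)
    (i j : nat) :
  (sigma j.-1 < sigma j)%E ->
  exists a b : R, overlap nu sigma i j = Num.max 0 (b - a) /\
    forall xi : R, (a < xi < b) =
      (nu i.-1 < xi < nu i) && (sigma j.-1 < xi%:E < sigma j)%E.
Proof.
move=> sj.
have [a aE] : exists a, Order.max (nu i.-1)%:E (sigma j.-1) = a%:E.
  case: (sigma j.-1) sj => [s|s|_].
  - by exists (Num.max (nu i.-1) s); rewrite EFin_max.
  - by rewrite ltNge leey in s.
  - by exists (nu i.-1); rewrite max_l ?leNye.
have [b bE] : exists b, Order.min (nu i)%:E (sigma j) = b%:E.
  case: (sigma j) sj => [s _|_|s].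
  - by exists (Num.min (nu i) s); rewrite EFin_min.
  - by exists (nu i); rewrite min_l ?leey.
  - by rewrite ltNge leNye in s.
exists a, b; split => [|xi]; first by rewrite /overlap bE aE -EFinB -EFin_max.
by rewrite -!lte_fin -aE -bE gt_max lt_min !lte_fin andbACA.
Qed.

(** A function that is constant on every cell and zero outside the fan agrees,
    off the break points, with the combination of the indicators of the cells. *)
Lemma integral_overlaps (R : realType) (N M : nat) (nu : nat -> R)
    (sigma : nat -> \bar R) (c : nat -> nat -> R) (h : R -> R) :
  fan_speeds N nu -> ref_partition M sigma ->
  (forall (i j : nat) (xi : R), (1 <= i <= N)%N -> (1 <= j <= M)%N ->
     nu i.-1 < xi < nu i -> (sigma j.-1 < xi%:E < sigma j)%E ->
     h xi = c i j) ->
  (forall xi : R, xi < nu 0%N \/ nu N < xi ->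
     (forall j : nat, (0 < j < M)%N -> sigma j <> xi%:E) -> h xi = 0) ->
  (\int[@lebesgue_measure R]_(xi in [set: R]) (h xi)%:E)%E =
  (\sum_(1 <= i < N.+1) \sum_(1 <= j < M.+1) overlap nu sigma i j * c i j)%:E.
Proof.
move=> nu_incr [s0 sM s_incr] hin hout.
pose cell i j (xi : R) : R :=
  ((nu i.-1 < xi < nu i) && (sigma j.-1 < xi%:E < sigma j)%E)%:R.
have cellP i j : (1 <= j <= M)%N ->
    has_integral (cell i j) (overlap nu sigma i j).
  move=> /s_incr /(overlap_itv nu i)[a [b [-> abE]]].
  apply: has_integral_ext (has_integral_itv a b false true) => xi.
  rewrite indicE /cell -abE; congr (_%:R); congr nat_of_bool.
  by apply/idP/idP; rewrite inE /= in_itv.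
(* The infinite bounds [sigma 0] and [sigma M] contribute the point 0, which is
   harmless: the list only has to contain the break points. *)
pose brk := [seq nu i | i <- iota 0 N.+1] ++
            [seq fine (sigma j) | j <- iota 0 M.+1].
suff : has_integral h (\sum_(1 <= i < N.+1) \sum_(1 <= j < M.+1)
         overlap nu sigma i j * c i j) by case.
apply: (@has_integral_eq_off_seq _ brk (fun xi =>
  \sum_(1 <= i < N.+1) \sum_(1 <= j < M.+1) c i j * cell i j xi)); last first.
  apply: has_integral_sum => i _; apply: has_integral_sum => j.
  rewrite mem_index_iota ltnS mulrC => jM.
  exact/has_integralZ/cellP.
move=> xi; rewrite mem_cat negb_or => /andP[xnu xsigma].
have {}xnu i : (i <= N)%N -> xi != nu i.
  by move=> iN; apply: contraNneq xnu => ->; rewrite map_f// mem_iota.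
have {}xsigma j : (j <= M)%N -> xi%:E != sigma j.
  move=> jM; apply: contraNneq xsigma => xj.
  by apply/mapP; exists j; rewrite ?mem_iota// -xj.
have sumE : \sum_(1 <= i < N.+1) \sum_(1 <= j < M.+1) c i j * cell i j xi =
    \sum_(1 <= i < N.+1) (nu i.-1 < xi < nu i)%R%:R *
      \sum_(1 <= j < M.+1) (sigma j.-1 < xi%:E < sigma j)%E%:R * c i j.
  apply: eq_bigr => i _; rewrite mulr_sumr; apply: eq_bigr => j _.
  by rewrite /cell -mulnb natrM mulrC mulrA.
rewrite sumE.
have [xin|/negP xout] := boolP (nu 0%N < xi < nu N).
  move/andP: xin => [x0 xN].
  have [i iN xi_i] := wedge_exists x0 xN xnu.
  have [||j jM xi_j] := @wedge_exists _ _ M sigma xi%:E _ _ xsigma.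
  - by rewrite s0 ltNyr.
  - by rewrite sM ltry.
  by rewrite (sum_wedge nu_incr _ iN xi_i) (sum_wedge s_incr _ jM xi_j)
    (hin i j).
rewrite hout => [|| j /andP[_ jM] sj].
- rewrite big_seq big1// => i; rewrite mem_index_iota ltnS => /andP[i1 iN].
  have [/andP[ix xi_]|_] := boolP (nu i.-1 < xi < nu i);
    last by rewrite mul0r.
  case: xout; apply/andP; split.
    apply: le_lt_trans ix; apply: (wedge_le nu_incr) => //.
    exact: leq_trans (leq_pred _) iN.
  exact: lt_le_trans xi_ (wedge_le nu_incr iN _).
- case: (ltgtP xi (nu 0%N)) (xnu 0%N isT) => // [|x0 _]; first by left.
  right; rewrite lt_neqAle eq_sym xnu//= leNgt.
  by apply/negP => xN; apply: xout; rewrite x0.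
- by have := xsigma j (ltnW jM); rewrite sj eqxx.
Qed.

Theorem theorem4p1 (R : realType) (e : R -> R) (he : internal_energy e)
  (rhom rhop : R) (vm vp : 'rV[R]_2) (hrhom : 0 < rhom) (hrhop : 0 < rhop)
  (N : nat) (hN : (1 <= N)%N) (nu : nat -> R) (hnu : fan_speeds N nu)
  (rho C : nat -> R)
  (hrho : forall i : nat, (1 <= i <= N)%N -> 0 < rho i)
  (hC : forall i : nat, (1 <= i <= N)%N -> 0 < C i)
  (M : nat) (sigma : nat -> \bar R) (hsigma : ref_partition M sigma)
  (rhoref : nat -> R) (vref : nat -> 'rV[R]_2)
  (hrhoref : forall j : nat, (1 <= j <= M)%N -> 0 < rhoref j)
  (hminus : rhoref 1%N = rhom /\ vref 1%N = vm)
  (hplus : rhoref M = rhop /\ vref M = vp)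
  (Hfan Lfan Href Lref : R -> R)
  (hHfan : fan_profile N nu (energy_density e rhom (sqnorm vm))
             (fun i => energy_density e (rho i) (C i))
             (energy_density e rhop (sqnorm vp)) Hfan)
  (hLfan : fan_profile N nu (action_density e rhom (sqnorm vm))
             (fun i => action_density e (rho i) (C i))
             (action_density e rhop (sqnorm vp)) Lfan)
  (hHref : ref_profile M sigma
             (fun j => energy_density e (rhoref j) (sqnorm (vref j))) Href)
  (hLref : ref_profile M sigma
             (fun j => action_density e (rhoref j) (sqnorm (vref j))) Lref)
  (hHagree : agree_outside_fan N M nu sigma Hfan Href)
  (hLagree : agree_outside_fan N M nu sigma Lfan Lref) :
  let K := kinetic_mismatch N M nu sigma rho C rhoref
             (fun j => sqnorm (vref j)) in
  let I := internal_mismatch N M nu sigma e rho rhoref in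
  entropy_rate Hfan Href = (- 2^-1 * K + I)%:E /\
  action_rate Lfan Lref = (2^-1 * K + I)%:E.
Proof.
move=> K I; split.
  rewrite /entropy_rate (integral_overlaps (c := fun i j =>
      energy_density e (rho i) (C i) -
      energy_density e (rhoref j) (sqnorm (vref j))) hnu hsigma).
  - rewrite /K /I /kinetic_mismatch /internal_mismatch mulr_sumr -big_split.
    congr EFin; apply: eq_bigr => i _; rewrite mulr_sumr -big_split.
    by apply: eq_bigr => j _; rewrite /energy_density /=; ring.
  - move=> i j xi iN jM xi_i xi_j.
    by case: hHfan => _ /(_ _ _ iN xi_i) -> _; rewrite (hHref _ _ jM xi_j).
  - by move=> xi xi_out xi_sigma; rewrite hHagree// subrr.
rewrite /action_rate (integral_overlaps (c := fun i j =>
    action_density e (rhoref j) (sqnorm (vref j)) -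
    action_density e (rho i) (C i)) hnu hsigma).
- rewrite /K /I /kinetic_mismatch /internal_mismatch mulr_sumr -big_split.
  congr EFin; apply: eq_bigr => i _; rewrite mulr_sumr -big_split.
  by apply: eq_bigr => j _; rewrite /action_density /=; ring.
- move=> i j xi iN jM xi_i xi_j.
  by case: hLfan => _ /(_ _ _ iN xi_i) -> _; rewrite (hLref _ _ jM xi_j).
- by move=> xi xi_out xi_sigma; rewrite hLagree// subrr.
Qed.
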